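(* Let $\mathbf L,\bar{\mathbf L},\mathbf U_\alpha,\bar{\mathbf U}_\alpha,\mathbf Q_\alpha,\bar{\mathbf Q}_\alpha$ ($\alpha=1,\dots,N$) be difference operators of Toda form (see context) satisfying, for all $\alpha,\beta$, the algebraic constraints $$[\mathbf L,\mathbf U_\alpha]=[\mathbf L,\mathbf Q_\alpha]=[\mathbf U_\beta,\mathbf Q_\alpha]=[\mathbf Q_\alpha,\mathbf Q_\beta]=0,\quad \mathbf U_\alpha\mathbf U_\beta=\delta_{\alpha\beta}\mathbf U_\beta,\quad \sum_{\alpha=1}^N\mathbf U_\alpha=1_N,$$ $$[\bar{\mathbf L},\bar{\mathbf U}_\alpha]=[\bar{\mathbf L},\bar{\mathbf Q}_\alpha]=[\bar{\mathbf U}_\beta,\bar{\mathbf Q}_\alpha]=[\bar{\mathbf Q}_\alpha,\bar{\mathbf Q}_\beta]=0,\quad \bar{\mathbf U}_\alpha\bar{\mathbf U}_\beta=\delta_{\alpha\beta}\bar{\mathbf U}_\beta,\quad \sum_{\alpha=1}^N\bar{\mathbf U}_\alpha=1_N.$$ Put $\mathbf B_{\alpha,n}=(\mathbf L^n\mathbf U_\alpha)_{\ge0}$ and $\bar{\mathbf B}_{\alpha,n}=(\bar{\mathbf L}^n\bar{\mathbf U}_\alpha)_{<0}$. (i) Suppose the Lax equations $$\frac{\partial\mathbf A}{\partial t_{\alpha,n}}=[\mathbf B_{\alpha,n},\mathbf A],\qquad \frac{\partial\mathbf A}{\partial\bar t_{\alpha,n}}=[\bar{\mathbf B}_{\alpha,n},\mathbf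 A]$$ hold for all $\alpha$, all $n\ge1$ and all $\mathbf A\in\{\mathbf L,\bar{\mathbf L},\mathbf U_\beta,\bar{\mathbf U}_\beta:\beta=1,\dots,N\}$. Then for all $\alpha,\beta$ and all $m,n\ge1$: $$\bigl[\partial_{t_{\alpha,m}}-\mathbf B_{\alpha,m},\,\partial_{t_{\beta,n}}-\mathbf B_{\beta,n}\bigr]=0,\quad \bigl[\partial_{\bar t_{\alpha,m}}-\bar{\mathbf B}_{\alpha,m},\,\partial_{\bar t_{\beta,n}}-\bar{\mathbf B}_{\beta,n}\bigr]=0,\quad \bigl[\partial_{t_{\alpha,m}}-\mathbf B_{\alpha,m},\,\partial_{\bar t_{\beta,n}}-\bar{\mathbf B}_{\beta,n}\bigr]=0,\qquad(\ast)$$ $$\bigl[\partial_{t_{\alpha,m}}+(\mathbf L^m\mathbf U_\alpha)_{<0},\,\partial_{t_{\beta,n}}+(\mathbf L^n\mathbf U_\beta)_{<0}\bigr]=0,\quad \bigl[\partial_{\bar t_{\alpha,m}}+(\bar{\mathbf L}^m\bar{\mathbf U}_\alpha)_{\ge0},\,\partial_{\bar t_{\beta,n}}+(\bar{\mathbf L}^n\bar{\mathbf U}_\beta)_{\ge0}\bigr]=0,$$ $$\bigl[\partial_{t_{\alpha,m}}+(\mathbf L^m\mathbf U_\alpha)_{<0},\,\partial_{\bar t_{\beta,n}}-\bar{\mathbf B}_{\beta,n}\bigr]=0,\quad \bigl[\partial_{t_{\alpha,m}}-\mathbf B_{\alpha,m},\,\partial_{\bar t_{\beta,n}}+(\bar{\mathbf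 L}^n\bar{\mathbf U}_\beta)_{\ge0}\bigr]=0.$$ (ii) Conversely, if the three families of equations $(\ast)$ hold for all $\alpha,\beta$ and $m,n\ge1$ (together with the algebraic constraints above), then the Lax equations of (i) hold for $\mathbf A=\mathbf L,\bar{\mathbf L},\mathbf U_\beta,\bar{\mathbf U}_\beta$ ($\beta=1,\dots,N$).
   Context: Fix $N\ge1$. Variables: $\mathbf s=(s_1,\dots,s_N)\in\mathbb Z^N$, $\mathbf t=(t_{\alpha,k})$, $\bar{\mathbf t}=(\bar t_{\alpha,k})$ with $1\le\alpha\le N$, $k\ge1$. All coefficients below are $N\times N$ complex matrix functions of $(\mathbf s,\mathbf t,\bar{\mathbf t})$. $E_\alpha$ is the diagonal matrix unit with $1$ at position $(\alpha,\alpha)$, $1_N$ the unit matrix, $\mathbf 1=(1,\dots,1)$, $[1]_\alpha$ the $\alpha$-th standard basis vector. $e^{\partial_{s_\alpha}}f(\mathbf s)=f(\mathbf s+[1]_\alpha)$, $e^{\partial_s}=\prod_\alpha e^{\partial_{s_\alpha}}$, so $e^{\partial_s}f(\mathbf s)=f(\mathbf s+\mathbf 1)$. Difference operators are formal sums $A=\sum_ja_j(\mathbf s)e^{j\partial_s}$ (infinite in at most one direction), possibly multiplied by integer powers of the $e^{\partial_{s_\alpha}}$, multiplied as operators; $A_{\ge0}=\sum_{j\ge0}a_je^{j\partial_s}$, $A_{<0}=\sum_{j<0}a_je^{j\partial_s}$. Time derivatives of an operator act on its coefficients. Operators of Toda form: $\mathbf L=\sum_{j\ge0}b_j(\mathbf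 s)e^{(1-j)\partial_s}$ with $b_0=1_N$; $\bar{\mathbf L}=\sum_{j\ge0}\bar b_j(\mathbf s)e^{(j-1)\partial_s}$ with $\bar b_0(\mathbf s)$ invertible; $\mathbf U_\alpha=\sum_{j\ge0}u_{\alpha,j}(\mathbf s)e^{-j\partial_s}$ with $u_{\alpha,0}=E_\alpha$; $\bar{\mathbf U}_\alpha=\sum_{j\ge0}\bar u_{\alpha,j}(\mathbf s)e^{j\partial_s}$; $\mathbf Q_\alpha=e^{-\partial_{s_\alpha}}\mathbf P_\alpha$, $\mathbf P_\alpha=\sum_{j\ge0}p_{\alpha,j}(\mathbf s)e^{-j\partial_s}$ with $p_{\alpha,0}=1_N$; $\bar{\mathbf Q}_\alpha=e^{-\partial_{s_\alpha}}\bar{\mathbf P}_\alpha$, $\bar{\mathbf P}_\alpha=\sum_{j\ge0}\bar p_{\alpha,j}(\mathbf s)e^{j\partial_s}$. *)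

(* Defs.v *)
From HB Require Import structures.
From mathcomp Require Export all_boot all_order all_algebra.
From mathcomp Require Export all_classical all_reals.
From mathcomp Require Export topology normedtype derive.
From mathcomp Require Export complex.

Set Implicit Arguments.
Unset Strict Implicit.
Unset Printing Implicit Defensive.
Export numFieldNormedType.Exports.
Export Order.TTheory GRing.Theory Num.Theory.

Declare Scope diffop_scope.
Delimit Scope diffop_scope with diffop.

Local Open Scope classical_set_scope.
Local Open Scope ring_scope.

Definition posn : Type := {n : nat | (0 < n)%N}.

(* The time variables: [inl (alpha, k)] is t_{alpha,k} and [inr (alpha, k)] is
   \bar t_{alpha,k}. A point [tau : times R N] carries both t and \bar t. *)
Definition tvar (N : nat) : Type := ('I_N * posn + 'I_N * posn)%type.
Definition tv (N : nat) (alpha : 'I_N) (n : posn) : tvar N := inl (alpha, n).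
Definition tbv (N : nat) (alpha : 'I_N) (n : posn) : tvar N := inr (alpha, n).

Definition times (R : realType) (N : nat) : Type := tvar N -> R[i].

Definition set_time (R : realType) (N : nat) (tau : times R N) (x : tvar N)
    (z : R[i]) : times R N :=
  fun y => if y == x then z else tau y.

Definition coeff (R : realType) (N : nat) : Type :=
  'rV[int]_N -> times R N -> 'M[R[i]]_N.

Definition differentiable_coeff (R : realType) (N : nat) (f : coeff R N) :
    Prop :=
  forall s tau x a b,
    derivable ((fun z => f s (set_time tau x z) a b) : R[i]^o -> R[i]^o)
      (tau x) 1.

Definition pderiv (R : realType) (N : nat) (x : tvar N) (f : coeff R N) :
    coeff R N :=
  fun s tau => \matrix_(a, b)
    derive1 ((fun z => f s (set_time tau x z) a b) : R[i]^o -> R[i]^o) (tau x).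

(* A formal sum \sum_v a_v(s) e^{v_1 \partial_{s_1} + ... + v_N \partial_{s_N}}
   over v in Z^N is encoded by its coefficient family v |-> a_v; in particular
   the coefficient of e^{j \partial_s} sits at [const_mx j]. *)
Definition diffop (R : realType) (N : nat) : Type := 'rV[int]_N -> coeff R N.

(* From a_v(s) e^{v.\partial} b_w(s) e^{w.\partial}
     = a_v(s) b_w(s + v) e^{(v + w).\partial}.
   The [\in] sum is over the support of the summand and is 0 when this support
   is infinite; whenever the product of two formal sums makes sense, the
   support is finite. *)
Definition opmul (R : realType) (N : nat) (A B : diffop R N) : diffop R N :=
  fun v s tau =>
    \sum_(w \in [set: 'rV[int]_N]) (A w s tau *m B (v - w) (s + w) tau).

Notation "A ** B" := (opmul A B) (at level 40, left associativity) :
  diffop_scope.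
Local Open Scope diffop_scope.

Definition opshift (R : realType) (N : nat) (v : 'rV[int]_N) : diffop R N :=
  fun w _ _ => if w == v then 1%:M else 0.

Definition op1 (R : realType) (N : nat) : diffop R N := opshift 0.

Definition oppow (R : realType) (N : nat) (A : diffop R N) (n : nat) :
    diffop R N := iter n (opmul A) (@op1 R N).

Definition opcomm (R : realType) (N : nat) (A B : diffop R N) : diffop R N :=
  A ** B - B ** A.

Definition opge0 (R : realType) (N : nat) (A : diffop R N) : diffop R N :=
  fun v => if `[< exists2 j : int, 0 <= j & v = const_mx j >] then A v else 0.

Definition oplt0 (R : realType) (N : nat) (A : diffop R N) : diffop R N :=
  fun v => if `[< exists2 j : int, j < 0 & v = const_mx j >] then A v else 0.

Definition optime (R : realType) (N : nat) (x : tvar N) (A : diffop R N) :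
    diffop R N := fun v => pderiv x (A v).

Definition differentiable_op (R : realType) (N : nat) (A : diffop R N) : Prop :=
  forall v, differentiable_coeff (A v).

(* A = \sum_{j >= 0} a_j(s) e^{(k - j) \partial_s}, with
   a_j = A (const_mx (k - j)). *)
Definition descending (R : realType) (N : nat) (k : int) (A : diffop R N) :
    Prop :=
  forall v, ~ (exists j : nat, v = const_mx (k - j%:Z)) -> A v = 0.

(* A = \sum_{j >= 0} a_j(s) e^{(k + j) \partial_s}, with
   a_j = A (const_mx (k + j)). *)
Definition ascending (R : realType) (N : nat) (k : int) (A : diffop R N) :
    Prop :=
  forall v, ~ (exists j : nat, v = const_mx (k + j%:Z)) -> A v = 0.

Definition toda_L (R : realType) (N : nat) (L : diffop R N) : Prop :=
  descending 1 L /\ forall s tau, L (const_mx 1) s tau = 1%:M.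

Definition toda_Lbar (R : realType) (N : nat) (Lb : diffop R N) : Prop :=
  ascending (-1) Lb /\ forall s tau, Lb (const_mx (-1)) s tau \in unitmx.

Definition toda_U (R : realType) (N : nat) (alpha : 'I_N) (U : diffop R N) :
    Prop :=
  descending 0 U /\
  forall s tau, U (const_mx 0) s tau = delta_mx alpha alpha.

Definition toda_Ubar (R : realType) (N : nat) (Ub : diffop R N) : Prop :=
  ascending 0 Ub.

Definition toda_Q (R : realType) (N : nat) (alpha : 'I_N) (Q : diffop R N) :
    Prop :=
  exists P : diffop R N,
    [/\ descending 0 P, forall s tau, P (const_mx 0) s tau = 1%:M &
        Q = opshift (- delta_mx 0 alpha) ** P].

Definition toda_Qbar (R : realType) (N : nat) (alpha : 'I_N) (Qb : diffop R N) :
    Prop :=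
  exists2 Pb : diffop R N,
    ascending 0 Pb & Qb = opshift (- delta_mx 0 alpha) ** Pb.

Record algebraic_constraints (R : realType) (N : nat) (L : diffop R N)
    (U Q : 'I_N -> diffop R N) : Prop := AlgebraicConstraints {
  comm_LU : forall alpha, opcomm L (U alpha) = 0;
  comm_LQ : forall alpha, opcomm L (Q alpha) = 0;
  comm_UQ : forall alpha beta, opcomm (U beta) (Q alpha) = 0;
  comm_QQ : forall alpha beta, opcomm (Q alpha) (Q beta) = 0;
  mul_UU : forall alpha beta,
    U alpha ** U beta = if alpha == beta then U beta else 0;
  sum_U : \sum_(alpha < N) U alpha = @op1 R N
}.

Definition Bop (R : realType) (N : nat) (L : diffop R N)
    (U : 'I_N -> diffop R N) (alpha : 'I_N) (n : posn) : diffop R N :=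
  opge0 (oppow L (val n) ** U alpha).

Definition Bbarop (R : realType) (N : nat) (Lb : diffop R N)
    (Ub : 'I_N -> diffop R N) (alpha : 'I_N) (n : posn) : diffop R N :=
  oplt0 (oppow Lb (val n) ** Ub alpha).

Definition Lax (R : realType) (N : nat) (L Lb : diffop R N)
    (U Ub : 'I_N -> diffop R N) (A : diffop R N) : Prop :=
  forall (alpha : 'I_N) (n : posn),
    optime (tv alpha n) A = opcomm (Bop L U alpha n) A /\
    optime (tbv alpha n) A = opcomm (Bbarop Lb Ub alpha n) A.

Definition Lax_equations (R : realType) (N : nat) (L Lb : diffop R N)
    (U Ub : 'I_N -> diffop R N) : Prop :=
  [/\ Lax L Lb U Ub L, Lax L Lb U Ub Lb,
      forall beta, Lax L Lb U Ub (U beta) &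
      forall beta, Lax L Lb U Ub (Ub beta)].

(* The commutator [\partial_x + A, \partial_y + B], expanded with
   [\partial_x, \partial_y] = 0 and [\partial_x, B] = \partial B / \partial x. *)
Definition zcomm (R : realType) (N : nat) (x : tvar N) (A : diffop R N)
    (y : tvar N) (B : diffop R N) : diffop R N :=
  optime x B - optime y A + opcomm A B.

Definition ZS_equations (R : realType) (N : nat) (L Lb : diffop R N)
    (U Ub : 'I_N -> diffop R N) : Prop :=
  forall (alpha beta : 'I_N) (m n : posn),
  [/\ zcomm (tv alpha m) (- Bop L U alpha m)
            (tv beta n) (- Bop L U beta n) = 0,
      zcomm (tbv alpha m) (- Bbarop Lb Ub alpha m)
            (tbv beta n) (- Bbarop Lb Ub beta n) = 0 &
      zcomm (tv alpha m) (- Bop L U alpha m)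
            (tbv beta n) (- Bbarop Lb Ub beta n) = 0].

Definition dual_ZS_equations (R : realType) (N : nat) (L Lb : diffop R N)
    (U Ub : 'I_N -> diffop R N) : Prop :=
  forall (alpha beta : 'I_N) (m n : posn),
  [/\ zcomm (tv alpha m) (oplt0 (oppow L (val m) ** U alpha))
            (tv beta n) (oplt0 (oppow L (val n) ** U beta)) = 0,
      zcomm (tbv alpha m) (opge0 (oppow Lb (val m) ** Ub alpha))
            (tbv beta n) (opge0 (oppow Lb (val n) ** Ub beta)) = 0,
      zcomm (tv alpha m) (oplt0 (oppow L (val m) ** U alpha))
            (tbv beta n) (- Bbarop Lb Ub beta n) = 0 &
      zcomm (tv alpha m) (- Bop L U alpha m)
            (tbv beta n) (opge0 (oppow Lb (val n) ** Ub beta)) = 0].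

(* Main.v *)
(* The operators split into two algebras, bounded above resp. below in powers of
   e^{\partial_s}, on which \partial_x - [G, -] is a derivation. Lax equations for
   L and U_alpha extend to W = L^n U_alpha. Writing W = B + C for its nonnegative
   and negative parts, [W, W'] = 0 makes the curvature of the -B equal to that of
   the C; one involves only nonnegative powers and the other only negative ones,
   so it vanishes.
   Conversely, the zero curvature equations show that the derivation, applied to
   L^n U_alpha, has order bounded independently of n; summing over alpha, the
   same holds for its value on L times L^n, which forces this value to be 0. *)
Require Import Defs.
From mathcomp Require Import zify.
Local Open Scope ring_scope.
Local Open Scope diffop_scope.

Set Implicit Arguments.
Unset Strict Implicit.
Unset Printing Implicit Defensive.

Lemma lez_addnP (k l : int) : reflect (exists m : nat, l = k + m%:Z) (k <= l).
Proof.
apply: (iffP idP) => [kl|[m ->]]; last by rewrite lerDl.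
by exists (absz (l - k)); lia.
Qed.

(** * Orders and supports of operators, in both directions at once *)

Section OrderedOperators.
Variables (R : realType) (n : nat).
Local Notation op := (diffop R n.+1).
Implicit Types (A B C : op) (b : bool) (k l : int).

(** The exponent of $e^{\pm l\partial_s}$, with the minus sign for [b = true]. The possibly infinite
    direction is then always that of growing [l], so every order is a lower bound. The size [n.+1]
    makes [dir b] injective. *)
Definition dir b l : 'rV[int]_n.+1 := const_mx ((-1) ^+ b * l).

Lemma dirD b k l : dir b (k + l) = dir b k + dir b l.
Proof. by apply/rowP => i; rewrite !mxE mulrDr. Qed.

Lemma dir0 b : dir b 0 = 0.
Proof. by apply/rowP => i; rewrite !mxE mulr0. Qed.

Lemma dir_inj b : injective (dir b).
Proof. by move=> k l /rowP /(_ ord0); rewrite !mxE; apply: mulfI; rewrite signr_eq0. Qed.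

Lemma dirN b l : dir (~~ b) (- l) = dir b l.
Proof. by apply/rowP => i; rewrite !mxE signrN mulrNN. Qed.

(* Both directions are treated at once: [order_ge true k] bounds the powers of
   e^{\partial_s} from above by -k, and [order_ge false k] from below by k. *)
Definition order_ge b k A : Prop :=
  forall v, ~ (exists2 l, k <= l & v = dir b l) -> A v = 0.

Lemma descendingE k A : descending k A <-> order_ge true (- k) A.
Proof.
split=> HA v Hv; apply: HA.
  case=> j vj; apply: Hv; rewrite vj; exists (- k + j%:Z); first by rewrite lerDl.
  by congr const_mx; rewrite expr1 mulN1r opprD opprK.
case=> l /lez_addnP[j ->] vj; apply: Hv; exists j; rewrite vj; congr const_mx.
by rewrite expr1 mulN1r opprD opprK.
Qed.

Lemma ascendingE k A : ascending k A <-> order_ge false k A.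
Proof.
split=> HA v Hv; apply: HA.
  case=> j vj; apply: Hv; rewrite vj; exists (k + j%:Z); first by rewrite lerDl.
  by congr const_mx; rewrite expr0 mul1r.
case=> l /lez_addnP[j ->] vj; apply: Hv; exists j; rewrite vj; congr const_mx.
by rewrite expr0 mul1r.
Qed.

Lemma order_ge_coef b k l A : order_ge b k A -> l < k -> A (dir b l) = 0.
Proof. by move=> HA lk; apply: HA => -[i ki /dir_inj li]; rewrite li ltNge ki in lk. Qed.

Lemma order_geW b k l A : l <= k -> order_ge b k A -> order_ge b l A.
Proof.
move=> lk HA v Hv; apply: HA => -[i ki vi]; apply: Hv.
by exists i => //; apply: le_trans ki.
Qed.

Lemma order_ge_incr b k A :
  order_ge b k A -> A (dir b k) = 0 -> order_ge b (k + 1) A.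
Proof.
move=> HA Ak v Hv; have [<-|vk] := eqVneq (dir b k) v; first by [].
apply: HA => -[l kl vl]; apply: Hv; exists l => //; rewrite lezD1 lt_neqAle kl.
by rewrite andbT; apply: contraNneq vk => ->; rewrite vl.
Qed.

Lemma order_ge_ext b k A B : order_ge b k A -> order_ge b k B ->
  (forall m : nat, A (dir b (k + m%:Z)) = B (dir b (k + m%:Z))) -> A = B.
Proof.
move=> HA HB AB; apply/funext => v.
have [[l /lez_addnP[m ->] ->]|nv] := pselect (exists2 l, k <= l & v = dir b l).
  exact: AB.
by rewrite HA ?HB.
Qed.

(** The bound 0 confines the support to the exponents [dir b m], and the bound [m.+1] removes the
    coefficient there. *)
Lemma order_ge_eq0 b A : (forall m : nat, order_ge b m%:Z A) -> A = 0.
Proof.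
move=> HA; apply/funext => v.
have [[l /lez_addnP[m ->] ->]|nv] := pselect (exists2 l, 0 <= l & v = dir b l).
  by apply: (order_ge_coef (HA m.+1)); rewrite add0r ltz_nat.
exact: (HA 0%N).
Qed.

Lemma order_geD b k A B : order_ge b k A -> order_ge b k B -> order_ge b k (A + B).
Proof. by move=> HA HB v Hv; rewrite fctE HA // HB // addr0. Qed.

Lemma order_geN b k A : order_ge b k A -> order_ge b k (- A).
Proof. by move=> HA v Hv; rewrite fctE HA // oppr0. Qed.

Lemma order_geB b k A B : order_ge b k A -> order_ge b k B -> order_ge b k (A - B).
Proof. by move=> HA HB; apply/order_geD/order_geN. Qed.

Lemma order_ge_op1 b : order_ge b 0 (@op1 R n.+1).
Proof.
move=> v Hv; rewrite /op1 /opshift; have [v0|//] := eqVneq v 0.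
by case: Hv; exists 0; rewrite ?dir0.
Qed.

(** Exponent [i] in one direction is [- i] in the other, so a nonzero coefficient would give $k\le
    i\le -l$, against $k+l>0$. *)
Lemma order_ge_disjoint b k l A :
  0 < k + l -> order_ge b k A -> order_ge (~~ b) l A -> A = 0.
Proof.
move=> kl HA HA'; apply/funext => v.
have [[i ki ->]|nv] := pselect (exists2 i, k <= i & v = dir b i); last exact: HA.
rewrite -dirN; apply: (order_ge_coef HA').
by rewrite ltrNl (lt_le_trans _ ki) // -subr_gt0 opprK.
Qed.

(** * Products as finite convolutions, and the ring laws *)

Lemma opmul_coef b k l A B (m : nat) s tau : order_ge b k A -> order_ge b l B ->
  (A ** B) (dir b (k + l + m%:Z)) s tau =
  \sum_(i < m.+1) A (dir b (k + i%:Z)) s tau *m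
    B (dir b (l + (m - i)%N%:Z)) (s + dir b (k + i%:Z)) tau.
Proof.
move=> HA HB; rewrite /opmul.
(* The left exponent is at least [k] and the right one at least [l], which leaves only the left
   exponents [k + i] with [i <= m]. The support being finite, the default value 0 of the [\in] sum
   does not intervene. *)
rewrite (fsbigE [seq dir b (k + i%:Z) | i <- index_iota 0 m.+1]).
- rewrite big_map big_mkord; apply: eq_big => [i|i _]; first by rewrite in_setT.
  congr (_ *m B _ _ _); apply/eqP; rewrite subr_eq -dirD; apply/eqP.
  by congr dir; have := ltn_ord i; lia.
- rewrite map_inj_in_uniq ?iota_uniq // => i j _ _ /dir_inj /addrI [] //.
- by [].
move=> w _; apply: contraNeq => w0; apply/mapP.
have [[i' /lez_addnP[i ->] wi]|nw] := pselect (exists2 i, k <= i & w = dir b i); last first.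
  by case/negP: w0; rewrite HA // mul0mx.
have [[j' /lez_addnP[j ->] wj]|nw] :=
    pselect (exists2 j, l <= j & dir b (k + l + m%:Z) - w = dir b j); last first.
  by case/negP: w0; rewrite (HB (_ - _)) // mulmx0.
exists i => //; rewrite mem_index_iota /=.
move: wj => /eqP; rewrite wi subr_eq -dirD => /eqP /dir_inj; lia.
Qed.


Lemma order_geM b k l A B :
  order_ge b k A -> order_ge b l B -> order_ge b (k + l) (A ** B).
Proof.
move=> HA HB v Hv; apply/funext => s; apply/funext => tau.
rewrite /opmul fsbig1 // => w _.
have [[i ki wi]|nw] := pselect (exists2 i, k <= i & w = dir b i); last first.
  by rewrite HA // mul0mx.
have [[j lj wj]|nw] := pselect (exists2 j, l <= j & v - w = dir b j); last first.
  by rewrite (HB (_ - _)) // mulmx0.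
case: Hv; exists (i + j); first exact: lerD.
by rewrite dirD -wi -wj addrC subrK.
Qed.

(** Each [b] gives one algebra of formal sums. Distributivity and associativity are asserted only
    inside such an algebra, since a coefficient of a product defaults to 0 when infinitely many
    terms contribute to it. *)
Definition bounded_op b A : Prop := exists k, order_ge b k A.

Lemma order_ge_bounded b k A : order_ge b k A -> bounded_op b A.
Proof. by exists k. Qed.

Lemma bounded_op2 b A B : bounded_op b A -> bounded_op b B ->
  exists k, order_ge b k A /\ order_ge b k B.
Proof.
move=> [k HA] [l HB]; exists (Num.min k l).
by split; [apply: order_geW HA|apply: order_geW HB]; rewrite ge_min lexx ?orbT.
Qed.

Lemma bounded_opD b A B : bounded_op b A -> bounded_op b B -> bounded_op b (A + B).
Proof.
by move=> HA HB; have [k [kA kB]] := bounded_op2 HA HB; exists k; apply: order_geD.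
Qed.

Lemma bounded_opN b A : bounded_op b A -> bounded_op b (- A).
Proof. by move=> [k HA]; exists k; apply: order_geN. Qed.

Lemma bounded_opM b A B : bounded_op b A -> bounded_op b B -> bounded_op b (A ** B).
Proof. by move=> [k HA] [l HB]; exists (k + l); apply: order_geM. Qed.

Lemma bounded_op1 b : bounded_op b (@op1 R n.+1).
Proof. by exists 0; apply: order_ge_op1. Qed.

Lemma opaddE A B v s tau : (A + B) v s tau = A v s tau + B v s tau.
Proof. by []. Qed.

Lemma opoppE A v s tau : (- A) v s tau = - A v s tau.
Proof. by []. Qed.

Lemma opmulDl b A A' B : bounded_op b A -> bounded_op b A' -> bounded_op b B ->
  (A + A') ** B = A ** B + A' ** B.
Proof.
move=> HA HA' [l HB]; have [k [kA kA']] := bounded_op2 HA HA'.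
apply: (@order_ge_ext b (k + l)) => [||m].
- by apply: order_geM => //; apply: order_geD.
- by apply: order_geD; apply: order_geM.
apply/funext => s; apply/funext => tau.
rewrite opaddE !(opmul_coef _ _ _ _ HB) //; last exact: order_geD.
by rewrite -big_split; apply: eq_bigr => i _; exact: mulmxDl.
Qed.

Lemma opmulDr b A B B' : bounded_op b A -> bounded_op b B -> bounded_op b B' ->
  A ** (B + B') = A ** B + A ** B'.
Proof.
move=> [k HA] HB HB'; have [l [lB lB']] := bounded_op2 HB HB'.
apply: (@order_ge_ext b (k + l)) => [||m].
- by apply: order_geM => //; apply: order_geD.
- by apply: order_geD; apply: order_geM.
apply/funext => s; apply/funext => tau.
rewrite opaddE !(opmul_coef _ _ _ HA) //; last exact: order_geD.
by rewrite -big_split; apply: eq_bigr => i _; exact: mulmxDr.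
Qed.

Lemma opmulNl b A B : bounded_op b A -> bounded_op b B -> (- A) ** B = - (A ** B).
Proof.
move=> [k HA] [l HB]; apply: (@order_ge_ext b (k + l)) => [||m].
- by apply: order_geM => //; apply: order_geN.
- by apply: order_geN; apply: order_geM.
apply/funext => s; apply/funext => tau.
rewrite opoppE !(opmul_coef _ _ _ _ HB) //; last exact: order_geN.
by rewrite -sumrN; apply: eq_bigr => i _; exact: mulNmx.
Qed.

Lemma opmulNr b A B : bounded_op b A -> bounded_op b B -> A ** (- B) = - (A ** B).
Proof.
move=> [k HA] [l HB]; apply: (@order_ge_ext b (k + l)) => [||m].
- by apply: order_geM => //; apply: order_geN.
- by apply: order_geN; apply: order_geM.
apply/funext => s; apply/funext => tau.
rewrite opoppE !(opmul_coef _ _ _ HA) //; last exact: order_geN.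
by rewrite -sumrN; apply: eq_bigr => i _; exact: mulmxN.
Qed.

Lemma op1mul A : @op1 R n.+1 ** A = A.
Proof.
apply/funext => v; apply/funext => s; apply/funext => tau; rewrite /opmul.
rewrite (fsbigE [:: 0 : 'rV[int]_n.+1]) // => [|w _]; last first.
  by rewrite inE /op1 /opshift => /negbTE ->; rewrite mul0mx.
by rewrite big_mkcond big_seq1 in_setT /op1 /opshift eqxx mul1mx subr0 addr0.
Qed.

Lemma opmul1 A : A ** @op1 R n.+1 = A.
Proof.
apply/funext => v; apply/funext => s; apply/funext => tau; rewrite /opmul.
rewrite (fsbigE [:: v]) // => [|w _]; last first.
  by rewrite inE /op1 /opshift subr_eq0 eq_sym => /negbTE ->; rewrite mulmx0.
by rewrite big_mkcond big_seq1 in_setT /op1 /opshift subrr eqxx mulmx1.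
Qed.

(** Summation of the triangle $j\le i\le m$ by rows and by columns, the reindexing behind
    associativity of a Cauchy product. *)
Lemma triangular_sum (V : nmodType) (F : nat -> nat -> V) (m : nat) :
  \sum_(i < m.+1) \sum_(j < i.+1) F j (i - j)%N =
  \sum_(j < m.+1) \sum_(i < (m - j).+1) F j i.
Proof.
elim: m => [|m IHm]; first by rewrite !big_ord1.
rewrite big_ord_recr IHm [RHS]big_ord_recr subnn big_ord1 /=.
rewrite [X in _ + X = _]big_ord_recr /= subnn addrA -big_split /=; congr (_ + _).
by apply: eq_bigr => j _; rewrite [in RHS]subSn -1?ltnS // [RHS]big_ord_recr /= subSn -1?ltnS.
Qed.

Lemma opmulA b A B C : bounded_op b A -> bounded_op b B -> bounded_op b C ->
  A ** (B ** C) = A ** B ** C.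
Proof.
move=> [k HA] [l HB] [h HC]; have HAB := order_geM HA HB; have HBC := order_geM HB HC.
apply: (@order_ge_ext b (k + l + h)) => [||m].
- by rewrite -addrA; apply: order_geM.
- exact: order_geM.
apply/funext => s; apply/funext => tau.
rewrite (opmul_coef _ _ _ HAB HC) -[k + l + h]addrA (opmul_coef _ _ _ HA HBC).
(* The common summand: [j], [i] and [m - (j + i)] are the excesses of the three exponents over the
   bounds [k], [l] and [h]. *)
pose F (j i : nat) := A (dir b (k + j%:Z)) s tau *m
  (B (dir b (l + i%:Z)) (s + dir b (k + j%:Z)) tau *m
   C (dir b (h + (m - (j + i))%N%:Z)) (s + dir b (k + l + (j + i)%N%:Z)) tau).
transitivity (\sum_(j < m.+1) \sum_(i < (m - j).+1) F j i).
  apply: eq_bigr => j _; rewrite (opmul_coef _ _ _ HB HC) mulmx_sumr.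
  apply: eq_bigr => i _; rewrite /F subnDA -[s + _ + _]addrA -dirD.
  by congr (_ *m (_ *m C _ (_ + dir _ _) _)); lia.
rewrite -triangular_sum; apply: eq_bigr => i _.
rewrite (opmul_coef _ _ _ HA HB) mulmx_suml; apply: eq_bigr => j _.
by rewrite /F subnKC -1?ltnS // mulmxA.
Qed.

(** * Nonnegative and negative parts *)

Lemma order_ge_opge0 A : order_ge false 0 (opge0 A).
Proof.
move=> v Hv; rewrite /opge0; case: asboolP => // -[l l0 vl]; case: Hv.
by exists l; rewrite // /dir expr0 mul1r.
Qed.

Lemma order_ge_oplt0 A : order_ge true 1 (oplt0 A).
Proof.
move=> v Hv; rewrite /oplt0; case: asboolP => // -[l l0 vl]; case: Hv.
by exists (- l); [lia|rewrite /dir expr1 mulN1r opprK].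
Qed.

Lemma opge0_order_ge b k A : order_ge b k A -> order_ge b k (opge0 A).
Proof. by move=> HA v Hv; rewrite /opge0; case: asboolP => // _; apply: HA. Qed.

Lemma oplt0_order_ge b k A : order_ge b k A -> order_ge b k (oplt0 A).
Proof. by move=> HA v Hv; rewrite /oplt0; case: asboolP => // _; apply: HA. Qed.

(** Both projections discard the exponents that are not multiples of $\mathbf 1$; boundedness
    ensures that none occur. *)
Lemma opge0D_lt0 b A : bounded_op b A -> opge0 A + oplt0 A = A.
Proof.
move=> [k HA]; apply/funext => v; rewrite fctE /opge0 /oplt0.
case: asboolP => [[i i0 vi]|Hge]; case: asboolP => [[j j0 vj]|Hlt]; rewrite ?add0r ?addr0 //.
  move: vi; rewrite vj => /rowP/(_ ord0); rewrite !mxE => ij.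
  by move: j0; rewrite ij ltNge i0.
rewrite HA // => -[l _ vl].
by case: (leP 0 ((-1) ^+ b * l)) => Hl; [apply: Hge|apply: Hlt]; exists ((-1) ^+ b * l).
Qed.

(** * Differentiation of coefficients in one time variable *)

Lemma differentiable_coeff_const (f : 'rV[int]_n.+1 -> 'M[R[i]]_n.+1) :
  differentiable_coeff (fun s (_ : times R n.+1) => f s).
Proof.
by move=> s tau x a c; exact: (@derivable_cst R[i] R[i]^o R[i]^o (f s a c : R[i]^o)).
Qed.

Lemma pderiv_const x (f : 'rV[int]_n.+1 -> 'M[R[i]]_n.+1) :
  pderiv x (fun s (_ : times R n.+1) => f s) = 0.
Proof.
apply/funext => s; apply/funext => tau; apply/matrixP => a c.
by rewrite mxE [RHS]mxE; exact: (@derive1_cst R[i] R[i]^o (f s a c)).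
Qed.

Lemma differentiable_coeff0 : differentiable_coeff (0 : coeff R n.+1).
Proof.
move=> s tau x a c; rewrite (_ : (fun z => _) = cst (0 : R[i]^o)).
  exact: derivable_cst.
by apply/funext => z; rewrite !fctE mxE.
Qed.

Lemma pderiv0 x : pderiv x (0 : coeff R n.+1) = 0.
Proof.
apply/funext => s; apply/funext => tau; apply/matrixP => a c.
rewrite mxE [RHS]mxE (_ : (fun z => _) = cst (0 : R[i]^o)) ?derive1_cst //.
by apply/funext => z; rewrite !fctE mxE.
Qed.

Lemma differentiable_opge0 A : differentiable_op A -> differentiable_op (opge0 A).
Proof.
move=> HA v; rewrite /opge0; case: asboolP => _; first exact: HA.
exact: differentiable_coeff0.
Qed.

Lemma differentiable_oplt0 A : differentiable_op A -> differentiable_op (oplt0 A).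
Proof.
move=> HA v; rewrite /oplt0; case: asboolP => _; first exact: HA.
exact: differentiable_coeff0.
Qed.

Lemma set_time_id (tau : times R n.+1) x : set_time tau x (tau x) = tau.
Proof. by apply/funext => y; rewrite /set_time; case: eqP => // ->. Qed.

Lemma is_derive_coeff (f : coeff R n.+1) s tau x a c : differentiable_coeff f ->
  is_derive (tau x : R[i]^o) 1
    ((fun z => f s (set_time tau x z) a c) : R[i]^o -> R[i]^o)
    (pderiv x f s tau a c).
Proof. by move=> Hf; rewrite mxE derive1E; apply/derivableP/Hf. Qed.

Lemma pderivP (f : coeff R n.+1) s tau x (d : 'M[R[i]]_n.+1) :
  (forall a c, is_derive (tau x : R[i]^o) 1
    ((fun z => f s (set_time tau x z) a c) : R[i]^o -> R[i]^o) (d a c)) ->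
  pderiv x f s tau = d.
Proof. by move=> Hf; apply/matrixP => a c; rewrite mxE derive1E derive_val. Qed.

Section Convolution.
Variables (m : nat) (F G : 'I_m -> coeff R n.+1) (w : 'I_m -> 'rV[int]_n.+1).
Hypotheses (dF : forall i, differentiable_coeff (F i))
  (dG : forall i, differentiable_coeff (G i)).

(** The shape that [opmul_coef] gives to a coefficient of a product. The shifts [w i] do not involve
    the times, so the Leibniz rule holds term by term. *)
Let conv : coeff R n.+1 := fun s tau => \sum_(i < m) F i s tau *m G i (s + w i) tau.

Lemma is_derive_convolution s tau x a c : is_derive (tau x : R[i]^o) 1
  ((fun z => conv s (set_time tau x z) a c) : R[i]^o -> R[i]^o)
  ((\sum_(i < m) (pderiv x (F i) s tau *m G i (s + w i) tau +
                  F i s tau *m pderiv x (G i) (s + w i) tau)) a c).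
Proof.
pose f i j : R[i]^o -> R[i]^o := fun z => F i s (set_time tau x z) a j.
pose g i j : R[i]^o -> R[i]^o := fun z => G i (s + w i) (set_time tau x z) j c.
have -> : (fun z => conv s (set_time tau x z) a c) =
    \sum_(i < m) \sum_(j < n.+1) (f i j * g i j).
  apply/funext => z; rewrite /conv summxE fct_sumE; apply: eq_bigr => i _.
  by rewrite mxE fct_sumE; apply: eq_bigr.
rewrite summxE; apply: is_derive_sum => i.
rewrite !mxE -big_split /=; apply: is_derive_sum => j.
have := is_deriveM (is_derive_coeff s tau x a j (@dF i))
  (is_derive_coeff (s + w i) tau x j c (@dG i)).
(* The product rule evaluates the undifferentiated factors at [set_time tau x (tau x)], which is
   [tau]. *)
rewrite !set_time_id => /is_derive_eq; apply; rewrite addrC; congr (_ + _); exact: mulrC.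
Qed.

Lemma differentiable_convolution : differentiable_coeff conv.
Proof. by move=> s tau x a c; case: (is_derive_convolution s tau x a c). Qed.

Lemma pderiv_convolution x : pderiv x conv = fun s tau =>
  \sum_(i < m) (pderiv x (F i) s tau *m G i (s + w i) tau +
                F i s tau *m pderiv x (G i) (s + w i) tau).
Proof.
by apply/funext => s; apply/funext => tau; apply/pderivP => a c; apply: is_derive_convolution.
Qed.

End Convolution.

(** * Powers and commutators *)

Lemma opmul0 A : A ** 0 = 0.
Proof.
apply/funext => v; apply/funext => s; apply/funext => tau.
by rewrite /opmul fsbig1 // => w _; rewrite mulmx0.
Qed.

Lemma op0mul A : 0 ** A = 0.
Proof.
apply/funext => v; apply/funext => s; apply/funext => tau.
by rewrite /opmul fsbig1 // => w _; rewrite mul0mx.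
Qed.

Lemma opmulBl b A A' B : bounded_op b A -> bounded_op b A' -> bounded_op b B ->
  (A - A') ** B = A ** B - A' ** B.
Proof.
by move=> HA HA' HB; rewrite (opmulDl (b := b)) ?(opmulNl (b := b)) //; apply: bounded_opN.
Qed.

Lemma opmulBr b A B B' : bounded_op b A -> bounded_op b B -> bounded_op b B' ->
  A ** (B - B') = A ** B - A ** B'.
Proof.
by move=> HA HB HB'; rewrite (opmulDr (b := b)) ?(opmulNr (b := b)) //; apply: bounded_opN.
Qed.

Lemma order_ge_sum b k (I : finType) (F : I -> op) :
  (forall i, order_ge b k (F i)) -> order_ge b k (\sum_i F i).
Proof. by move=> HF; elim/big_ind: _ => // A B; apply: order_geD. Qed.

Lemma order_ge_oppow b k A m :
  order_ge b k A -> order_ge b (k *+ m) (oppow A m).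
Proof.
move=> HA; elim: m => [|m IHm]; first exact: order_ge_op1.
by rewrite mulrS; apply: order_geM.
Qed.

Lemma bounded_oppow b A m : bounded_op b A -> bounded_op b (oppow A m).
Proof. by move=> [k /order_ge_oppow HA]; exists (k *+ m). Qed.

Lemma opcommC A B : opcomm A B = - opcomm B A.
Proof. by rewrite /opcomm opprB. Qed.

Lemma bounded_opcomm b A B : bounded_op b A -> bounded_op b B -> bounded_op b (opcomm A B).
Proof. by move=> HA HB; apply/bounded_opD/bounded_opN; apply: bounded_opM. Qed.

Lemma order_ge_opcomm b k l A B :
  order_ge b k A -> order_ge b l B -> order_ge b (k + l) (opcomm A B).
Proof. by move=> HA HB; apply: order_geB; last rewrite addrC; apply: order_geM. Qed.

Lemma opcommDr b A B B' : bounded_op b A -> bounded_op b B -> bounded_op b B' ->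
  opcomm A (B + B') = opcomm A B + opcomm A B'.
Proof.
move=> HA HB HB'; rewrite /opcomm (opmulDr HA HB HB') (opmulDl HB HB' HA).
by rewrite opprD addrACA.
Qed.

Lemma opcommNr b A B : bounded_op b A -> bounded_op b B -> opcomm A (- B) = - opcomm A B.
Proof. by move=> HA HB; rewrite /opcomm (opmulNr HA HB) (opmulNl HB HA) opprD. Qed.

Lemma opcommDl b A A' B : bounded_op b A -> bounded_op b A' -> bounded_op b B ->
  opcomm (A + A') B = opcomm A B + opcomm A' B.
Proof.
by move=> HA HA' HB; rewrite opcommC (opcommDr HB HA HA') opprD -!(opcommC _ B).
Qed.

Lemma opcommNl b A B : bounded_op b A -> bounded_op b B -> opcomm (- A) B = - opcomm A B.
Proof. by move=> HA HB; rewrite opcommC (opcommNr HB HA) -(opcommC A B). Qed.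

Lemma opcommMr b A B C : bounded_op b A -> bounded_op b B -> bounded_op b C ->
  opcomm A (B ** C) = opcomm A B ** C + B ** opcomm A C.
Proof.
move=> HA HB HC; have HM := bounded_opM (b := b).
rewrite /opcomm (opmulBl (b := b)) ?(opmulBr (b := b)) //; do ?exact: HM.
by rewrite !(opmulA (b := b)) // addrA subrK.
Qed.

Lemma opcomm_eq0M b A B C : bounded_op b A -> bounded_op b B -> bounded_op b C ->
  opcomm A B = 0 -> opcomm A C = 0 -> opcomm A (B ** C) = 0.
Proof.
by move=> HA HB HC ABC0 ACC0; rewrite (opcommMr HA HB HC) ABC0 ACC0 opmul0 op0mul addr0.
Qed.

Lemma opcomm1 A : opcomm A (@op1 R n.+1) = 0.
Proof. by rewrite /opcomm opmul1 op1mul subrr. Qed.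

Lemma opcomm_eq0X b A B m : bounded_op b A -> bounded_op b B ->
  opcomm A B = 0 -> opcomm A (oppow B m) = 0.
Proof.
move=> HA HB AB; elim: m => [|m IHm]; first exact: opcomm1.
by apply: (opcomm_eq0M HA HB) => //; apply: bounded_oppow.
Qed.

Lemma opcommAA A : opcomm A A = 0. Proof. by rewrite /opcomm subrr. Qed.

Lemma opcomm_eq0C A B : opcomm A B = 0 -> opcomm B A = 0.
Proof. by move=> AB0; rewrite opcommC AB0 oppr0. Qed.

(** * Time derivatives of operators and the Leibniz rule *)

Lemma differentiable_opM b A B : bounded_op b A -> bounded_op b B ->
  differentiable_op A -> differentiable_op B -> differentiable_op (A ** B).
Proof.
move=> [k HA] [l HB] dA dB v.
have [[l' /lez_addnP[m ->] ->]|nv] := pselect (exists2 i, k + l <= i & v = dir b i); last first.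
  by rewrite (order_geM HA HB nv); apply: differentiable_coeff0.
rewrite (_ : (A ** B) _ = fun s tau => \sum_(i < m.+1) A (dir b (k + i%:Z)) s tau *m
    B (dir b (l + (m - i)%N%:Z)) (s + dir b (k + i%:Z)) tau).
  exact: (differentiable_convolution (fun i => dA _) (fun i => dB _)).
by apply/funext => s; apply/funext => tau; apply: opmul_coef.
Qed.

Lemma order_ge_optime b k A x : order_ge b k A -> order_ge b k (optime x A).
Proof.
by move=> HA v Hv; rewrite /optime (HA v Hv) pderiv0.
Qed.

Lemma bounded_optime b A x : bounded_op b A -> bounded_op b (optime x A).
Proof. by move=> [k HA]; exists k; apply: order_ge_optime. Qed.

Lemma optimeM b x A B : bounded_op b A -> bounded_op b B ->
  differentiable_op A -> differentiable_op B ->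
  optime x (A ** B) = optime x A ** B + A ** optime x B.
Proof.
move=> [k HA] [l HB] dA dB; have HAB := order_geM HA HB.
have HA' := order_ge_optime x HA; have HB' := order_ge_optime x HB.
apply: (@order_ge_ext b (k + l)) => [||m]; first exact: order_ge_optime.
  by apply: order_geD; apply: order_geM.
pose F (i : 'I_m.+1) := A (dir b (k + i%:Z)).
pose G (i : 'I_m.+1) := B (dir b (l + (m - i)%N%:Z)).
pose w (i : 'I_m.+1) := dir b (k + i%:Z).
have ABE : (A ** B) (dir b (k + l + m%:Z)) =
    fun s tau => \sum_(i < m.+1) F i s tau *m G i (s + w i) tau.
  by apply/funext => s; apply/funext => tau; apply: opmul_coef.
rewrite /optime ABE (@pderiv_convolution _ F G w (fun i => dA _) (fun i => dB _)).
apply/funext => s; apply/funext => tau.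
by rewrite opaddE (opmul_coef _ _ _ HA' HB) (opmul_coef _ _ _ HA HB') -big_split.
Qed.

Lemma is_derive_coeffD (f g : coeff R n.+1) s tau x a c :
  differentiable_coeff f -> differentiable_coeff g ->
  is_derive (tau x : R[i]^o) 1
    ((fun z => (f + g) s (set_time tau x z) a c) : R[i]^o -> R[i]^o)
    ((pderiv x f s tau + pderiv x g s tau) a c).
Proof.
move=> df dg; rewrite (_ : (fun z => _) =
    (fun z : R[i]^o => f s (set_time tau x z) a c : R[i]^o) +
    (fun z : R[i]^o => g s (set_time tau x z) a c : R[i]^o)).
  by rewrite mxE; apply: is_deriveD; apply: is_derive_coeff.
by apply/funext => z; rewrite !fctE mxE.
Qed.

Lemma is_derive_coeffN (f : coeff R n.+1) s tau x a c : differentiable_coeff f ->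
  is_derive (tau x : R[i]^o) 1
    ((fun z => (- f) s (set_time tau x z) a c) : R[i]^o -> R[i]^o)
    ((- pderiv x f s tau) a c).
Proof.
move=> df; rewrite (_ : (fun z => _) =
    - (fun z : R[i]^o => f s (set_time tau x z) a c : R[i]^o)).
  by rewrite mxE; apply: is_deriveN; apply: is_derive_coeff.
by apply/funext => z; rewrite !fctE mxE.
Qed.

Lemma differentiable_opD A B :
  differentiable_op A -> differentiable_op B -> differentiable_op (A + B).
Proof.
by move=> dA dB v s tau x a c; case: (is_derive_coeffD s tau x a c (@dA v) (@dB v)).
Qed.

Lemma differentiable_opN A : differentiable_op A -> differentiable_op (- A).
Proof. by move=> dA v s tau x a c; case: (is_derive_coeffN s tau x a c (@dA v)). Qed.

Lemma optimeD x A B : differentiable_op A -> differentiable_op B ->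
  optime x (A + B) = optime x A + optime x B.
Proof.
move=> dA dB; apply/funext => v; apply/funext => s; apply/funext => tau.
by apply: pderivP => a c; apply: is_derive_coeffD.
Qed.

Lemma optimeN x A : differentiable_op A -> optime x (- A) = - optime x A.
Proof.
move=> dA; apply/funext => v; apply/funext => s; apply/funext => tau.
by apply: pderivP => a c; apply: is_derive_coeffN.
Qed.

(** * Bounded differentiable operators and covariant derivation *)

Definition smooth_op b A : Prop := bounded_op b A /\ differentiable_op A.

Lemma smooth_opD b A B : smooth_op b A -> smooth_op b B -> smooth_op b (A + B).
Proof.
by move=> [HA dA] [HB dB]; split; [apply: bounded_opD|apply: differentiable_opD].
Qed.

Lemma smooth_opN b A : smooth_op b A -> smooth_op b (- A).
Proof. by move=> [HA dA]; split; [apply: bounded_opN|apply: differentiable_opN]. Qed.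

Lemma smooth_opM b A B : smooth_op b A -> smooth_op b B -> smooth_op b (A ** B).
Proof.
by move=> [HA dA] [HB dB]; split; [apply: bounded_opM|apply: differentiable_opM HA HB _ _].
Qed.

Lemma differentiable_op1 : differentiable_op (@op1 R n.+1).
Proof. by move=> v; exact: differentiable_coeff_const. Qed.

Lemma smooth_oppow b A m : smooth_op b A -> smooth_op b (oppow A m).
Proof.
move=> HA; elim: m => [|m IHm]; last exact: smooth_opM.
by split; [apply: bounded_op1|apply: differentiable_op1].
Qed.

(* [covd x G A] stands for [\partial_x - G, A]. *)
Definition covd x G A : op := optime x A - opcomm G A.

Lemma covdD b x G A B : bounded_op b G -> smooth_op b A -> smooth_op b B ->
  covd x G (A + B) = covd x G A + covd x G B.
Proof.
move=> HG [HA dA] [HB dB]; rewrite /covd optimeD // (opcommDr HG HA HB).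
by rewrite opprD addrACA.
Qed.

(** Both $\partial_x$ and $[G,\cdot]$ are derivations, hence so is their difference. *)
Lemma covdM b x G A B : bounded_op b G -> smooth_op b A -> smooth_op b B ->
  covd x G (A ** B) = covd x G A ** B + A ** covd x G B.
Proof.
move=> HG [HA dA] [HB dB].
have HxA := bounded_optime x HA; have HxB := bounded_optime x HB.
rewrite /covd (optimeM x HA HB dA dB) (opcommMr HG HA HB).
rewrite (opmulBl HxA (bounded_opcomm HG HA) HB) (opmulBr HA HxB (bounded_opcomm HG HB)).
by rewrite opprD addrACA.
Qed.

Lemma optime_op1 x : optime x (@op1 R n.+1) = 0.
Proof. by apply/funext => v; exact: pderiv_const. Qed.

Lemma covd_oppow_eq0 b x G A m : bounded_op b G -> smooth_op b A ->
  covd x G A = 0 -> covd x G (oppow A m) = 0.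
Proof.
move=> HG HA DA; elim: m => [|m IHm].
  by rewrite /covd [oppow _ _]/= optime_op1 opcomm1 subr0.
by rewrite [oppow _ _]/= (covdM x HG HA (smooth_oppow m HA)) DA IHm op0mul opmul0 addr0.
Qed.

(** The time derivative keeps the order [l], while the commutator with [G] shifts it by [k]. *)
Lemma order_ge_covd b x k l G A : order_ge b k G -> order_ge b l A ->
  order_ge b (Num.min l (k + l)) (covd x G A).
Proof.
move=> HG HA; apply: order_geB.
  by apply: order_geW (order_ge_optime x HA); rewrite ge_min lexx.
by apply: order_geW (order_ge_opcomm HG HA); rewrite ge_min lexx orbT.
Qed.

Lemma bounded_covd b x G A : bounded_op b G -> bounded_op b A -> bounded_op b (covd x G A).
Proof. by move=> [k HG] [l HA]; eexists; apply: order_ge_covd HG HA. Qed.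

(** * Zero curvature expressions and changes of potential *)

Lemma zcommC x A y B : zcomm x A y B = - zcomm y B x A.
Proof. by rewrite /zcomm [RHS]opprD -(opcommC A B) opprB. Qed.

Lemma zcommDl b x A A' y B : smooth_op b A -> smooth_op b A' -> bounded_op b B ->
  zcomm x (A + A') y B = zcomm x A y B + (opcomm A' B - optime y A').
Proof.
move=> [HA dA] [HA' dA'] HB; rewrite /zcomm optimeD // (opcommDl HA HA' HB).
move: (optime x B) (optime y A) (optime y A') (opcomm A B) (opcomm A' B) => a c d e f.
by rewrite opprD [a + _]addrA addrACA [- d + f]addrC.
Qed.

(* A flow commuting with [\partial_y + M] can be added to the first potential. *)
Lemma zcomm_shift b x P C y M : smooth_op b P -> smooth_op b C -> bounded_op b M ->
  optime y (P + C) = opcomm (- M) (P + C) -> zcomm x C y M = zcomm x (- P) y M.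
Proof.
move=> HP HC HM EW; have HW := smooth_opD HP HC.
have -> : C = - P + (P + C) by rewrite addKr.
rewrite (zcommDl x y (smooth_opN HP) HW HM) EW (opcommNl HM HW.1).
by rewrite (opcommC M) !opprK addrN addr0 // addKr.
Qed.

(** The two potentials are shifted one after the other. With $W_i=P_i+C_i$, commutation of $W_1$ and
    $W_2$ gives $[P_2,W_1]=[-C_2,W_1]$, which brings the second evolution equation into the form
    needed by the first shift. *)
Lemma zcomm_split b x y P1 C1 P2 C2 :
  smooth_op b P1 -> smooth_op b C1 -> smooth_op b P2 -> smooth_op b C2 ->
  opcomm (P1 + C1) (P2 + C2) = 0 ->
  optime x (P2 + C2) = opcomm P1 (P2 + C2) ->
  optime y (P1 + C1) = opcomm P2 (P1 + C1) ->
  zcomm x C1 y C2 = zcomm x (- P1) y (- P2).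
Proof.
move=> HP1 HC1 HP2 HC2 W12 E2 E1.
have HW1 := smooth_opD HP1 HC1; have HW2 := smooth_opD HP2 HC2.
rewrite (zcomm_shift x HP1 HC1 HC2.1).
  rewrite zcommC (zcomm_shift y HP2 HC2 (bounded_opN HP1.1)) ?opprK //.
  by rewrite -zcommC.
rewrite E1 -[C2 in RHS](addKr P2) opprD opprK.
rewrite (opcommDl HP2.1 (bounded_opN HW2.1) HW1.1) (opcommNl HW2.1 HW1.1).
by rewrite (opcomm_eq0C W12) oppr0 addr0.
Qed.

(** Orders add up in the commutator; as both are nonnegative, their sum is below neither of them. *)
Lemma order_ge_zcomm b k l x A y B : 0 <= k -> 0 <= l ->
  order_ge b k A -> order_ge b l B -> order_ge b (Num.min k l) (zcomm x A y B).
Proof.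
move=> k0 l0 HA HB; apply: order_geD; first apply: order_geB.
- by apply: order_geW (order_ge_optime x HB); rewrite ge_min lexx orbT.
- by apply: order_geW (order_ge_optime y HA); rewrite ge_min lexx.
- by apply: order_geW (order_ge_opcomm HA HB); rewrite ge_min lerDl l0.
Qed.

(** Closes the direct implication: a curvature written once with nonnegative and once with negative
    potentials has no exponent left. *)
Lemma nonneg_neg_eq0 A : order_ge false 0 A -> order_ge true 1 A -> A = 0.
Proof. exact: (@order_ge_disjoint false 0 1). Qed.

Lemma nonneg_zcomm x A y B :
  order_ge false 0 A -> order_ge false 0 B -> order_ge false 0 (zcomm x A y B).
Proof. exact: order_ge_zcomm. Qed.

Lemma neg_zcomm x A y B :
  order_ge true 1 A -> order_ge true 1 B -> order_ge true 1 (zcomm x A y B).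
Proof. exact: order_ge_zcomm. Qed.

(** * Cancelling powers of an operator with invertible leading coefficient *)

Lemma order_ge_mulr_unit b k A B : bounded_op b A -> order_ge b (- 1) B ->
  (forall s tau, B (dir b (- 1)) s tau \in unitmx) ->
  order_ge b k (A ** B) -> order_ge b (k + 1) A.
Proof.
move=> [l HA] HB uB HAB.
suff HAm (m : nat) : l + m%:Z <= k + 1 -> order_ge b (l + m%:Z) A.
  have [/lez_addnP[m E]|kl] := leP l (k + 1); first by rewrite E; apply: HAm; rewrite E.
  exact: order_geW (ltW kl) HA.
elim: m => [|m IHm] lm; first by rewrite addr0.
have lm' : l + m%:Z <= k + 1 by lia.
have HAm := IHm lm'; rewrite (_ : l + m.+1%:Z = l + m%:Z + 1); last by lia.
apply: order_ge_incr => //; apply/funext => s; apply/funext => tau.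
(* The lowest coefficient of the product is a single term: that of [A] times a shifted leading
   coefficient of [B]. It sits at [l + m - 1], below [k], hence vanishes, and the invertible factor
   cancels. *)
have := opmul_coef 0 s tau HAm HB; rewrite big_ord1 !addr0.
rewrite (order_ge_coef HAB); last by lia.
by move=> /(congr1 (mulmx^~ (invmx (B (dir b (-1)) (s + dir b (l + m%:Z)) tau))));
  rewrite mul0mx mulmxK // => <-.
Qed.

Lemma order_ge_mulr_oppow b k A B m : bounded_op b A -> order_ge b (- 1) B ->
  (forall s tau, B (dir b (- 1)) s tau \in unitmx) ->
  order_ge b k (A ** oppow B m) -> order_ge b (k + m%:Z) A.
Proof.
move=> HA HB uB; have bB := order_ge_bounded HB.
elim: m A HA => [|m IHm] A HA; first by rewrite [oppow _ _]/= opmul1 addr0.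
rewrite [oppow _ _]/= (opmulA HA bB (bounded_oppow m bB)) => HAB.
rewrite (_ : k + m.+1%:Z = k + m%:Z + 1); last by lia.
by apply: order_ge_mulr_unit HB uB _ => //; apply: IHm => //; apply: bounded_opM.
Qed.

(** Since [k] does not depend on [m], cancelling [oppow B m] gives [A] order at least [k + m] for
    every positive [m], that is, infinite order. *)
Lemma mulr_oppow_eq0 b k A B : bounded_op b A -> order_ge b (- 1) B ->
  (forall s tau, B (dir b (- 1)) s tau \in unitmx) ->
  (forall m : nat, (0 < m)%N -> order_ge b k (A ** oppow B m)) -> A = 0.
Proof.
move=> HA HB uB HAB; apply: (@order_ge_eq0 b) => m.
have [j mj] : exists j : nat, m%:Z <= k + j.+1%:Z by exists (m + absz k)%N; lia.
by apply: order_geW mj _; apply: (order_ge_mulr_oppow HA HB uB); apply: HAB.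
Qed.

Lemma opmul_sumr b k l A (I : finType) (F : I -> op) : order_ge b l A ->
  (forall i, order_ge b k (F i)) -> A ** (\sum_i F i) = \sum_i A ** F i.
Proof.
move=> HA HF.
(* The order bound is carried through the induction because distributivity needs bounded partial
   sums. *)
suff [] : order_ge b k (\sum_i F i) /\ A ** (\sum_i F i) = \sum_i A ** F i by [].
elim/big_ind2: _ => [|B AB C AC [HB <-] [HC <-]|i _]; rewrite ?opmul0 //.
by split; [apply: order_geD|apply: (opmulDr (order_ge_bounded HA)); eexists; eauto].
Qed.

(* If [covd y G (L^m U_i)] is bounded uniformly in [m], then so is
   [covd y G L ** L^m], which forces [covd y G L = 0] because the leading
   coefficient of [L] is invertible; likewise for the [U_i]. *)
Lemma covd_eq0_of_bounded b c y G L (I : finType) (U : I -> op) :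
  bounded_op b G -> smooth_op b L -> order_ge b (- 1) L ->
  (forall s tau, L (dir b (- 1)) s tau \in unitmx) ->
  (forall i, smooth_op b (U i)) -> (forall i, order_ge b 0 (U i)) ->
  (forall i, opcomm L (U i) = 0) -> \sum_i U i = @op1 R n.+1 ->
  (forall m i, (0 < m)%N -> order_ge b c (covd y G (oppow L m ** U i))) ->
  covd y G L = 0 /\ forall i, covd y G (U i) = 0.
Proof.
move=> HG HL L1 uL HU U0 LU U1 HW; have bDL := bounded_covd y HG HL.1.
have HLm m := smooth_oppow m HL; have Lm m := bounded_oppow m HL.1.
have DL0 : covd y G L = 0.
  (* The loss of one comes from the left factor [L], of order -1, in the Leibniz rule below. *)
  apply: (mulr_oppow_eq0 (k := c - 1) bDL L1 uL) => m m0.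
  have bA := bounded_opM bDL (Lm m).
  rewrite -[_ ** oppow L m]opmul1 -U1; have [k HA] := bA.
  rewrite (opmul_sumr HA U0); apply: order_ge_sum => i.
  have HLU := smooth_opM (HLm m) (HU i).
  rewrite -(opmulA bDL (Lm m) (HU i).1).
  (* Writing $D$ for [covd y G], the Leibniz rule gives $D(L)L^mU_i=D(L^{m+1}U_i)-L\,D(L^mU_i)$. *)
  rewrite -[X in order_ge _ _ X](addrK (L ** covd y G (oppow L m ** U i))).
  rewrite -(covdM y HG HL HLU) (opmulA HL.1 (Lm m) (HU i).1).
  apply: order_geB; first by apply: order_geW (HW m.+1 i _) => //; lia.
  by rewrite addrC; apply: order_geM => //; apply: HW.
split=> // i; have bDU := bounded_covd y HG (HU i).1.
apply: (mulr_oppow_eq0 (k := c) bDU L1 uL) => m m0; have := HW m i m0.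
(* As $U_i$ commutes with $L^m$ and $D(L^m)=0$, one has $D(L^mU_i)=D(U_i)L^m$. *)
have LmU : oppow L m ** U i = U i ** oppow L m.
  have := opcomm_eq0X m (HU i).1 HL.1 (opcomm_eq0C (LU i)).
  by move=> /eqP; rewrite subr_eq0 => /eqP.
rewrite LmU (covdM y HG (HU i) (HLm m)) (covd_oppow_eq0 m HG HL DL0) opmul0.
by rewrite addr0.
Qed.

Lemma smooth_opge0 b A : smooth_op b A -> smooth_op b (opge0 A).
Proof.
by move=> [[k HA] dA]; split; [exists k; apply: opge0_order_ge|apply: differentiable_opge0].
Qed.

Lemma smooth_oplt0 b A : smooth_op b A -> smooth_op b (oplt0 A).
Proof.
by move=> [[k HA] dA]; split; [exists k; apply: oplt0_order_ge|apply: differentiable_oplt0].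
Qed.

Lemma covd_eq0 x G A : covd x G A = 0 <-> optime x A = opcomm G A.
Proof. by split=> [/eqP|E]; [rewrite subr_eq0 => /eqP|rewrite /covd E subrr]. Qed.

(** The source of the uniform bound: $\partial_xG$ has at least the order of [G], whatever [P]
    is. *)
Lemma covd_of_zcomm b x y P G : smooth_op b P -> smooth_op b G ->
  zcomm x (- P) y (- G) = 0 -> covd y G P = optime x G.
Proof.
move=> [HP dP] [HG dG]; rewrite /zcomm /covd !optimeN //.
rewrite (opcommNl HP (bounded_opN HG)) (opcommNr HP HG) (opcommC P G).
move: (optime x G) (optime y P) (opcomm G P) => a c d.
by rewrite !opprK -addrA addrC => /eqP; rewrite subr_eq0 => /eqP.
Qed.

(** * The operators $L^mU_i$ and their flows *)

Section Hierarchy.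
Variables (b : bool) (I : finType) (L : op) (U : I -> op).
Hypotheses (smooth_L : smooth_op b L) (smooth_U : forall i, smooth_op b (U i)).
Hypothesis opcomm_LU : forall i, opcomm L (U i) = 0.

Lemma opcomm_hierarchy i j (m k : nat) : opcomm (U i) (U j) = 0 ->
  opcomm (oppow L m ** U i) (oppow L k ** U j) = 0.
Proof.
move=> UU; have HLm (l : nat) := (smooth_oppow l smooth_L).1.
have HL := smooth_L.1; have HU i' := (smooth_U i').1.
have HW (l : nat) i' := bounded_opM (HLm l) (HU i').
have LW (l : nat) i' : opcomm L (oppow L l ** U i') = 0.
  by apply: (opcomm_eq0M HL) => //; apply: (opcomm_eq0X l HL) => //; apply: opcommAA.
apply: (opcomm_eq0M (HW m i)) => //.
  by apply: (opcomm_eq0X k (HW m i)) => //; apply: opcomm_eq0C.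
apply/opcomm_eq0C/(opcomm_eq0M (HU j)) => //; last exact: opcomm_eq0C.
by apply: (opcomm_eq0X m (HU j)) => //; apply: opcomm_eq0C.
Qed.

Lemma optime_hierarchy y G i m : bounded_op b G ->
  optime y L = opcomm G L -> optime y (U i) = opcomm G (U i) ->
  optime y (oppow L m ** U i) = opcomm G (oppow L m ** U i).
Proof.
move=> HG /covd_eq0 DL /covd_eq0 DU; apply/covd_eq0.
rewrite (covdM y HG (smooth_oppow m smooth_L) (smooth_U i)) DU opmul0.
by rewrite (covd_oppow_eq0 m HG smooth_L DL) op0mul addr0.
Qed.

(** [P] is the half of $L^mU_i$ that generates a flow and [C] the other half. Keeping [b], [t], [y]
    and [G] general covers all four pairings of an algebra with a family of times. *)
Lemma lax_of_zcomm (P C : I -> posn -> op) (t : I -> posn -> tvar n.+1) y G :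
  order_ge b (- 1) L -> (forall s tau, L (dir b (- 1)) s tau \in unitmx) ->
  (forall i, order_ge b 0 (U i)) -> \sum_i U i = @op1 R n.+1 ->
  (forall i m, P i m + C i m = oppow L (val m) ** U i) ->
  (forall i m, smooth_op b (P i m)) -> (forall i m, smooth_op b (C i m)) ->
  (forall i m, order_ge b 0 (C i m)) -> smooth_op b G ->
  (forall i m, zcomm (t i m) (- P i m) y (- G) = 0) ->
  optime y L = opcomm G L /\ forall i, optime y (U i) = opcomm G (U i).
Proof.
move=> L1 uL U0 U1 PC HP HC C0 HG ZS; have [g Gg] := HG.1.
(* With [g] a lower bound for the order of [G], the contributions of [P] and [C] have orders at
   least [g] and [Num.min 0 g]. *)
have [|DL DU] := @covd_eq0_of_bounded b (Num.min g 0) y G L I U HG.1 smooth_L L1 uL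
  smooth_U U0 opcomm_LU U1.
  move=> m i m0; rewrite -(PC i (exist _ m m0)) (covdD y HG.1 (HP _ _) (HC _ _)).
  rewrite (covd_of_zcomm (HP _ _) HG (ZS _ _)); apply: order_geD.
    by apply: order_geW (order_ge_optime _ Gg); rewrite ge_min lexx.
  by apply: order_geW (order_ge_covd y Gg (C0 _ _)); rewrite addr0 minC.
by split=> [|i]; apply/covd_eq0.
Qed.

End Hierarchy.
End OrderedOperators.

Theorem proposition2p1 (R : realType) (N : nat) (N_ge1 : (1 <= N)%N)
    (L Lb : diffop R N) (U Ub Q Qb : 'I_N -> diffop R N)
    (form_L : toda_L L) (form_Lb : toda_Lbar Lb)
    (form_U : forall alpha, toda_U alpha (U alpha))
    (form_Ub : forall alpha, toda_Ubar (Ub alpha))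
    (form_Q : forall alpha, toda_Q alpha (Q alpha))
    (form_Qb : forall alpha, toda_Qbar alpha (Qb alpha))
    (diff_L : differentiable_op L) (diff_Lb : differentiable_op Lb)
    (diff_U : forall alpha, differentiable_op (U alpha))
    (diff_Ub : forall alpha, differentiable_op (Ub alpha))
    (constraints : algebraic_constraints L U Q)
    (constraints_bar : algebraic_constraints Lb Ub Qb) :
  (Lax_equations L Lb U Ub ->
     ZS_equations L Lb U Ub /\ dual_ZS_equations L Lb U Ub) /\
  (ZS_equations L Lb U Ub -> Lax_equations L Lb U Ub).
Proof.
(* For [N = 0] all [const_mx j] coincide and exponents carry no order; [N_ge1] excludes this
   case. *)
destruct N as [|n]; first by [].
have [/descendingE L1 lead_L] := form_L.
have [/ascendingE Lb1 lead_Lb] := form_Lb.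
have U0 i : order_ge true 0 (U i) by have [/descendingE] := form_U i; rewrite oppr0.
have Ub0 i : order_ge false 0 (Ub i) by apply/ascendingE/form_Ub.
(* In their own directions the leading exponents $e^{\partial_s}$ of [L] and $e^{-\partial_s}$ of
   [Lb] both have order -1. *)
have uL s tau : L (dir n true (- 1)) s tau \in unitmx.
  by rewrite /dir expr1 mulN1r opprK lead_L unitmx1.
have uLb s tau : Lb (dir n false (- 1)) s tau \in unitmx.
  by rewrite /dir expr0 mul1r.
have HL : smooth_op true L by split; [exists (- 1)|].
have HLb : smooth_op false Lb by split; [exists (- 1)|].
have HU i : smooth_op true (U i) by split; [exists 0; exact: U0|exact: diff_U].
have HUb i : smooth_op false (Ub i) by split; [exists 0; exact: Ub0|exact: diff_Ub].
have LU := comm_LU constraints; have LbUb := comm_LU constraints_bar.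
have UU i j : opcomm (U i) (U j) = 0.
  rewrite /opcomm !(mul_UU constraints) [j == i]eq_sym.
  by case: eqP => [->|_]; rewrite subrr.
have UbUb i j : opcomm (Ub i) (Ub j) = 0.
  rewrite /opcomm !(mul_UU constraints_bar) [j == i]eq_sym.
  by case: eqP => [->|_]; rewrite subrr.
pose W i (m : posn) := oppow L (val m) ** U i.
pose Wb i (m : posn) := oppow Lb (val m) ** Ub i.
have HW i m : smooth_op true (W i m) by apply/smooth_opM/HU/smooth_oppow.
have HWb i m : smooth_op false (Wb i m) by apply/smooth_opM/HUb/smooth_oppow.
pose B := Bop L U; pose C i m := oplt0 (W i m).
pose Bb := Bbarop Lb Ub; pose Cb i m := opge0 (Wb i m).
have HB i m : smooth_op true (B i m) := smooth_opge0 (HW i m).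
have HC i m : smooth_op true (C i m) := smooth_oplt0 (HW i m).
have HBb i m : smooth_op false (Bb i m) := smooth_oplt0 (HWb i m).
have HCb i m : smooth_op false (Cb i m) := smooth_opge0 (HWb i m).
have nnB i m : order_ge false 0 (B i m) := order_ge_opge0 (W i m).
have nnCb i m : order_ge false 0 (Cb i m) := order_ge_opge0 (Wb i m).
have ngC i m : order_ge true 1 (C i m) := order_ge_oplt0 (W i m).
have ngBb i m : order_ge true 1 (Bb i m) := order_ge_oplt0 (Wb i m).
(* The projection cuts off the infinite direction, so [B] and [Bb] are finite sums and lie in both
   algebras; each can thus act on the operators of the other kind. *)
have HB' i m : smooth_op false (B i m) by split; [exists 0; exact: nnB|exact: (HB i m).2].
have HBb' i m : smooth_op true (Bb i m) by split; [exists 1; exact: ngBb|exact: (HBb i m).2].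
have BC i m : B i m + C i m = W i m := opge0D_lt0 (HW i m).1.
have BCb i m : Bb i m + Cb i m = Wb i m.
  by rewrite addrC; exact: (opge0D_lt0 (HWb i m).1).
split=> [[laxL laxLb laxU laxUb]|ZS].
  have tW i m j k : optime (tv i m) (W j k) = opcomm (B i m) (W j k).
    exact: (optime_hierarchy HL HU (val k) (HB i m).1 (laxL i m).1 (laxU j i m).1).
  have tbW i m j k : optime (tbv i m) (W j k) = opcomm (Bb i m) (W j k).
    exact: (optime_hierarchy HL HU (val k) (HBb' i m).1 (laxL i m).2 (laxU j i m).2).
  have tWb i m j k : optime (tv i m) (Wb j k) = opcomm (B i m) (Wb j k).
    exact: (optime_hierarchy HLb HUb (val k) (HB' i m).1 (laxLb i m).1 (laxUb j i m).1).
  have tbWb i m j k : optime (tbv i m) (Wb j k) = opcomm (Bb i m) (Wb j k).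
    exact: (optime_hierarchy HLb HUb (val k) (HBb i m).1 (laxLb i m).2 (laxUb j i m).2).
  have ttE i m j k : zcomm (tv i m) (C i m) (tv j k) (C j k) =
      zcomm (tv i m) (- B i m) (tv j k) (- B j k).
    apply: (zcomm_split (HB i m) (HC i m) (HB j k) (HC j k)); rewrite !BC.
    - exact: (opcomm_hierarchy HL HU LU _ _ (UU i j)).
    - exact: tW.
    - exact: tW.
  have bbE i m j k : zcomm (tbv i m) (Cb i m) (tbv j k) (Cb j k) =
      zcomm (tbv i m) (- Bb i m) (tbv j k) (- Bb j k).
    apply: (zcomm_split (HBb i m) (HCb i m) (HBb j k) (HCb j k)); rewrite !BCb.
    - exact: (opcomm_hierarchy HLb HUb LbUb _ _ (UbUb i j)).
    - exact: tbWb.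
    - exact: tbWb.
  (* [W] and [Wb] belong to opposite algebras and no commutation between them is given, so the mixed
     curvature is changed in one potential at a time: the first here, the second in [btE]. *)
  have tbE i m j k : zcomm (tv i m) (C i m) (tbv j k) (- Bb j k) =
      zcomm (tv i m) (- B i m) (tbv j k) (- Bb j k).
    apply: (zcomm_shift _ (HB i m) (HC i m) (bounded_opN (HBb' j k).1)).
    by rewrite opprK BC; exact: tbW.
  have btE i m j k : zcomm (tv i m) (- B i m) (tbv j k) (Cb j k) =
      zcomm (tv i m) (- B i m) (tbv j k) (- Bb j k).
    rewrite zcommC [RHS]zcommC; congr (- _).
    apply: (zcomm_shift _ (HBb j k) (HCb j k) (bounded_opN (HB' i m).1)).
    by rewrite opprK BCb; exact: tWb.
  have tt0 i m j k : zcomm (tv i m) (- B i m) (tv j k) (- B j k) = 0.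
    apply: nonneg_neg_eq0; last by rewrite -ttE; exact: neg_zcomm (ngC i m) (ngC j k).
    exact: nonneg_zcomm (order_geN (nnB i m)) (order_geN (nnB j k)).
  have bb0 i m j k : zcomm (tbv i m) (- Bb i m) (tbv j k) (- Bb j k) = 0.
    apply: nonneg_neg_eq0; first by rewrite -bbE; exact: nonneg_zcomm (nnCb i m) (nnCb j k).
    exact: neg_zcomm (order_geN (ngBb i m)) (order_geN (ngBb j k)).
  (* The mixed curvature has only nonnegative powers once [Cb] replaces [- Bb], and only negative
     ones once [C] replaces [- B]. *)
  have tb0 i m j k : zcomm (tv i m) (- B i m) (tbv j k) (- Bb j k) = 0.
    apply: nonneg_neg_eq0; [rewrite -btE|rewrite -tbE].
      exact: nonneg_zcomm (order_geN (nnB i m)) (nnCb j k).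
    exact: neg_zcomm (ngC i m) (order_geN (ngBb j k)).
  split=> i j m k; split; first exact: tt0.
  - exact: bb0.
  - exact: tb0.
  - exact: etrans (ttE i m j k) (tt0 i m j k).
  - exact: etrans (bbE i m j k) (bb0 i m j k).
  - exact: etrans (tbE i m j k) (tb0 i m j k).
  - exact: etrans (btE i m j k) (tb0 i m j k).
(* The converse needs only order 0 for the complementary half, which [Cb] has already. *)
have C0 i m : order_ge true 0 (C i m) := order_geW (isT : (0 : int) <= 1) (ngC i m).
have tP i m : optime (tv i m) L = opcomm (B i m) L /\
    forall j, optime (tv i m) (U j) = opcomm (B i m) (U j).
  apply: (lax_of_zcomm HL HU LU L1 uL U0 (sum_U constraints) BC HB HC C0 (HB i m)
    (t := @tv n.+1)) => j k.
  by have [ZS1 _ _] := ZS j i k m; exact: ZS1.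
have tbP i m : optime (tbv i m) L = opcomm (Bb i m) L /\
    forall j, optime (tbv i m) (U j) = opcomm (Bb i m) (U j).
  apply: (lax_of_zcomm HL HU LU L1 uL U0 (sum_U constraints) BC HB HC C0 (HBb' i m)
    (t := @tv n.+1)) => j k.
  by have [_ _ ZS3] := ZS j i k m; exact: ZS3.
have tPb i m : optime (tv i m) Lb = opcomm (B i m) Lb /\
    forall j, optime (tv i m) (Ub j) = opcomm (B i m) (Ub j).
  apply: (lax_of_zcomm HLb HUb LbUb Lb1 uLb Ub0 (sum_U constraints_bar) BCb HBb HCb nnCb
    (HB' i m) (t := @tbv n.+1)) => j k.
  (* The mixed equations list the time $t$ first, so antisymmetry puts them in the required
     order. *)
  by rewrite zcommC; case: (ZS i j m k) => _ _ ->; rewrite oppr0.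
have tbPb i m : optime (tbv i m) Lb = opcomm (Bb i m) Lb /\
    forall j, optime (tbv i m) (Ub j) = opcomm (Bb i m) (Ub j).
  apply: (lax_of_zcomm HLb HUb LbUb Lb1 uLb Ub0 (sum_U constraints_bar) BCb HBb HCb nnCb
    (HBb i m) (t := @tbv n.+1)) => j k.
  by have [_ ZS2 _] := ZS j i k m; exact: ZS2.
split=> [i m|i m|j i m|j i m]; split.
- exact: (tP i m).1.
- exact: (tbP i m).1.
- exact: (tPb i m).1.
- exact: (tbPb i m).1.
- exact: (tP i m).2.
- exact: (tbP i m).2.
- exact: (tPb i m).2.
- exact: (tbPb i m).2.
Qed.
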